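(* Let $G$ be a finite group and $m$ an integer. Choose a set $\underline{\mathrm{Cl}}(G)$ of representatives of the conjugacy classes of $G$, and, for each $z\in\underline{\mathrm{Cl}}(G)$, a set $\underline{\mathrm{Cl}}(C_G(z))$ of representatives for the conjugacy classes of $C_G(z)$. For $z\in\underline{\mathrm{Cl}}(G)$ and $h\in\underline{\mathrm{Cl}}(C_G(z))$ choose an element $t(h,z)\in G$ such that $g(h):=t(h,z)\triangleright h\in\underline{\mathrm{Cl}}(G)$. Then $$\nu_m(\Xi)=\sum_{z\in\underline{\mathrm{Cl}}(G)}\ \sum_{h\in\underline{\mathrm{Cl}}(C_G(z))}\frac1{|C_G(h,z)|}\,\gamma_m^z(h)\,\Xi\bigl(g(h),t(h,z)\triangleright z\bigr)$$ for every character $\Xi$ of $D(G)$, and $$\nu_m(g,\eta)=\frac1{|C_G(g)|}\sum_{z\in\underline{\mathrm{Cl}}(G)}\ \sum_{\substack{h\in\underline{\mathrm{Cl}}(C_G(z))\\ g(h)=g}}|z^{C_G(h)}|\,\gamma_m^z(h)\,\eta\bigl(t(h,z)\triangleright z\bigr)$$ for every $g\in\underline{\mathrm{Cl}}(G)$ and $\eta\in\mathrm{Irr}(C_G(g))$.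
   Context: $t\triangleright x:=txt^{-1}$; $C_G(z)$ is the centralizer of $z$ and $C_G(h,z)=C_G(h)\cap C_G(z)$; $z^{H}$ is the conjugacy class of $z$ in $H$; $\mathrm{Irr}(H)$ is the set of irreducible complex characters of $H$. For $z\in G$ the class function $\gamma_m^z\colon C_G(z)\to\mathbb C$ is $\gamma_m^z(g)=|\{x\in G\mid x^m=(gx)^m=z\}|$. Modules over the Drinfeld double $D(G)$ (over $\mathbb C$) are described by pairs $(g,\eta)$ with $g\in G$ and $\eta$ a character of $C_G(g)$ (every module is a direct sum of such); the simple ones correspond to $\eta\in\mathrm{Irr}(C_G(g))$. The character of the module associated to $(g,\eta)$ is the function $\Xi$ on commuting pairs $(x,y)\in G^2$ given by $\Xi(x,y)=\eta(tyt^{-1})$ if $t\in G$ satisfies $txt^{-1}=g$, and $\Xi(x,y)=0$ if $x$ is not conjugate to $g$. Characters of $D(G)$ are sums of such functions. $\nu_m(g,\eta)$ denotes the $m$-th (higher) Frobenius-Schur indicator of the $D(G)$-module associated to $(g,\eta)$; by a known result of Kashina-Sommerhäuser-Zhu, which may be taken as the definition, $\nu_m(g,\eta)=\frac1{|C_G(g)|}\sum_{x\in G,\ x^m=(gx)^m}\eta(x^m)$. For the character $\Xi$ of a $D(G)$-module $V$, $\nu_m(\Xi)=\nu_m(V)$; it is additive in $\Xi$, and $\nu_m(\Xi)=\nu_m(g,\eta)$ if $\Xi$ is the character associated to $(g,\eta)$. *)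

(* Defs.v *)
From HB Require Import structures.
From mathcomp Require Import all_boot all_order all_algebra all_fingroup.
From mathcomp Require Import all_solvable all_field all_character.

Set Implicit Arguments.
Unset Strict Implicit.
Unset Printing Implicit Defensive.

Import GroupScope Order.TTheory GRing.Theory Num.Theory.
Local Open Scope ring_scope.

(* MathComp has no integer powers in groups; [Negz n] stands for - (n + 1). *)
Definition expgz (gT : finGroupType) (x : gT) (m : int) : gT :=
  match m with
  | Posz n => (x ^+ n)%g
  | Negz n => (x ^- n.+1)%g
  end.

(* Left conjugation; MathComp's [x ^ t] is the right action t^-1 * x * t. *)
Definition lconj (gT : finGroupType) (t x : gT) : gT := (t * x * t^-1)%g.

Definition gamma (gT : finGroupType) (G : {group gT}) (m : int) (z g : gT) : nat :=
  #|[set x in G | (expgz x m == z) && (expgz (g * x)%g m == z)]|.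

(* The D(G)-module attached to a pair (g, eta). The values of its character
   are independent of the conjugating element picked here, because [eta] is a
   class function on 'C_G[g]; see [pair_charE].  The character is only
   meaningful on commuting pairs of elements of [G]. *)
Definition pair_char (gT : finGroupType) (G : {group gT}) (g : gT)
    (eta : 'CF('C_G[g])) (x y : gT) : algC :=
  if [pick t in G | lconj t x == g] is Some t then eta (lconj t y) else 0.

Definition pair_nu (gT : finGroupType) (G : {group gT}) (m : int) (g : gT)
    (eta : 'CF('C_G[g])) : algC :=
  #|'C_G[g]|%:R^-1 *
    \sum_(x in G | expgz x m == expgz (g * x)%g m) eta (expgz x m).

Record dsummand (gT : finGroupType) (G : {group gT}) := DSummand {
  dbase : gT;
  dchar : 'CF('C_G[dbase]);
  dbase_in : dbase \in G;
  dcharP : dchar \is a character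
}.

(* Every D(G)-module is a finite direct sum of modules attached to pairs;
   a module is represented by the list of pairs of such a decomposition, and
   its character and indicators are the sums over the summands. *)
Definition dmodule (gT : finGroupType) (G : {group gT}) := seq (dsummand G).

Definition module_char (gT : finGroupType) (G : {group gT}) (V : dmodule G)
    (x y : gT) : algC :=
  \sum_(s <- V) pair_char (dchar s) x y.

Definition module_nu (gT : finGroupType) (G : {group gT}) (m : int)
    (V : dmodule G) : algC :=
  \sum_(s <- V) pair_nu m (dchar s).

Lemma pair_charE (gT : finGroupType) (G : {group gT}) (g : gT)
    (eta : 'CF('C_G[g])) (x y t : gT) :
  t \in G -> lconj t x = g ->
  pair_char eta x y = eta (lconj t y).
Proof.
move=> tG txg; rewrite /pair_char; case: pickP => [s|/(_ t)]; last first.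
  by rewrite tG txg eqxx.
case/andP=> sG /eqP sxg.
have -> : lconj s y = (lconj t y ^ (t * s^-1))%g.
  by rewrite /lconj conjgE invMg invgK !mulgA !mulgKV.
apply: cfunJ; rewrite inE groupM ?groupV //; apply/cent1P.
have gt : (g * t = t * x)%g by rewrite -txg /lconj mulgKV.
have gs : (s^-1 * g = x * s^-1)%g by rewrite -sxg /lconj !mulgA mulVg mul1g.
by rewrite /commute mulgA gt -!mulgA gs.
Qed.

Lemma pair_char0 (gT : finGroupType) (G : {group gT}) (g : gT)
    (eta : 'CF('C_G[g])) (x y : gT) :
  (forall t, t \in G -> lconj t x <> g) -> pair_char eta x y = 0.
Proof.
move=> nxg; rewrite /pair_char; case: pickP => // t /andP[tG /eqP].
by move/(nxg t tG).
Qed.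

(* Main.v *)
Require Import Defs.
From HB Require Import structures.
From mathcomp Require Import all_boot all_order all_algebra all_fingroup.
From mathcomp Require Import all_solvable all_field all_character.

Set Implicit Arguments.
Unset Strict Implicit.
Unset Printing Implicit Defensive.

Import GroupScope Order.TTheory GRing.Theory Num.Theory.
Local Open Scope ring_scope.

(* With Xi the character of (g, eta), the function
   (h, z) |-> gamma_m^z(h) Xi(h, z) on G x G is invariant under simultaneous
   conjugation and vanishes off commuting pairs.  Grouping its sum by the class
   of h gives |G| nu_m(g, eta); grouping it by the class of z, and then by the
   class of h in C_G(z), gives |G| times the right-hand side. *)

Lemma lconjE (gT : finGroupType) (t x : gT) : lconj t x = (x ^ t^-1)%g.
Proof. by rewrite /lconj conjgE invgK mulgA. Qed.

Lemma expgzJ (gT : finGroupType) (x y : gT) (m : int) :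
  expgz (x ^ y)%g m = (expgz x m ^ y)%g.
Proof. by case: m => n; rewrite /expgz ?conjVg conjXg. Qed.

Lemma commute_expgz (gT : finGroupType) (x y : gT) (m : int) :
  commute x y -> commute x (expgz y m).
Proof.
by move=> cxy; case: m => n; rewrite /expgz; do ?apply: commuteV; apply: commuteX.
Qed.

Lemma expgz_in (gT : finGroupType) (G : {group gT}) (x : gT) (m : int) :
  x \in G -> expgz x m \in G.
Proof. by move=> Gx; case: m => n; rewrite /expgz ?groupV groupX. Qed.

(** Each element of [K] is conjugate to exactly one element of [X], so [K] is the disjoint union of
    the classes of these, and [f] is constant on each class. *)
Lemma sum_transversal (gT : finGroupType) (K : {group gT}) (X : {set gT})
    (f : gT -> algC) :
  is_transversal X (classes K) K ->
  (forall x y, x \in K -> y \in K -> f (x ^ y)%g = f x) ->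
  \sum_(x in K) f x = \sum_(x in X) #|x ^: K|%:R * f x.
Proof.
case/and3P=> _ sXK /forall_inP Xtr fJ.
transitivity (\sum_(x in X) \sum_(y in K | y \in x ^: K) f y); last first.
  apply: eq_bigr => x Xx; have Kx := subsetP sXK x Xx.
  rewrite (eq_bigl (mem (x ^: K))) => [|y]; last first.
    by rewrite andb_idl //; apply: subsetP y; rewrite class_subG.
  rewrite (eq_bigr (fun=> f x)) => [|_ /imsetP[y Ky ->]]; last exact: fJ.
  by rewrite sumr_const mulr_natl.
rewrite (exchange_big_dep (mem K)) /=; last by move=> x y _ /andP[].
apply: eq_bigr => y Ky.
(* After the exchange, [f y] occurs once for each element of [X] in the class of [y], and the
   transversal has exactly one there. *)
have /Xtr/eqP XyK: y ^: K \in classes K by apply: mem_classes.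
rewrite sumr_const -[LHS]mulr1n -[in LHS]XyK; congr (_ *+ _).
by apply: eq_card => x; rewrite [in LHS]inE -[RHS]topredE /= Ky class_sym.
Qed.

Lemma transversal_class_inj (gT : finGroupType) (K : {group gT}) (X : {set gT})
    (x y : gT) :
  is_transversal X (classes K) K -> x \in X -> y \in X -> x \in y ^: K -> x = y.
Proof.
case/and3P=> _ sXK /forall_inP Xtr Xx Xy yKx.
have /Xtr/cards1P[w Xw]: y ^: K \in classes K.
  by apply: mem_classes; apply: (subsetP sXK).
have: x \in X :&: y ^: K by rewrite inE Xx.
have: y \in X :&: y ^: K by rewrite inE Xy class_refl.
by rewrite Xw !inE => /eqP-> /eqP->.
Qed.

Lemma gammaJ (gT : finGroupType) (G : {group gT}) (m : int) (z h u : gT) :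
  u \in G -> gamma G m (z ^ u)%g (h ^ u)%g = gamma G m z h.
Proof.
move=> Gu; rewrite /gamma -[RHS](card_imset _ (conjg_inj u)); congr #|pred_of_set _|.
apply/setP=> x; rewrite -[x](conjgKV u) (mem_imset _ _ (conjg_inj u)).
by rewrite !inE -conjMg !expgzJ !(inj_eq (conjg_inj u)) groupJr.
Qed.

(** If [x] and [h * x] both have [m]-th power [z], then both commute with [z], and hence so does
    [h]. *)
Lemma gamma_eq0 (gT : finGroupType) (G : {group gT}) (m : int) (z h : gT) :
  h \notin 'C[z] -> gamma G m z h = 0%N.
Proof.
move=> nczh; apply/eqP; rewrite cards_eq0; apply: contraR nczh.
case/set0Pn=> x; rewrite inE => /and3P[_ /eqP <- /eqP eq_hx].
have cx: x \in 'C[expgz x m] by apply/cent1P/commute_expgz.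
rewrite -(groupMr _ cx); apply/cent1P; rewrite -eq_hx.
exact/commute_expgz.
Qed.

(** If [t] conjugates [x] to [g], then [t * u] conjugates [x ^ u] to [g] and sends [y ^ u] to the
    same element as [t] sends [y]. *)
Lemma pair_charJ (gT : finGroupType) (G : {group gT}) (g : gT)
    (eta : 'CF('C_G[g])) (x y u : gT) :
  u \in G -> pair_char eta (x ^ u)%g (y ^ u)%g = pair_char eta x y.
Proof.
move=> Gu.
case: (pickP [pred t in G | lconj t x == g]) => [t /andP[Gt /eqP tx] | ntx].
  rewrite (pair_charE _ _ Gt tx) (@pair_charE _ _ _ _ _ _ (t * u)%g) ?groupM //.
    by rewrite !lconjE invMg conjgM conjgK.
  by rewrite -tx !lconjE invMg conjgM conjgK.
rewrite !pair_char0 // => t Gt tx.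
  by have := ntx t; rewrite /= Gt tx eqxx.
(* A conjugator [t] for [x ^ u] would yield the conjugator [t * u^-1] for [x]. *)
have := ntx (t * u^-1)%g.
by rewrite /= groupM ?groupV // -tx !lconjE invMg invgK conjgM eqxx.
Qed.

Lemma card_class_cent1 (gT : finGroupType) (K : {group gT}) (x : gT) :
  (#|x ^: K| * #|'C_K[x]|)%N = #|K|.
Proof. by rewrite -index_cent1 mulnC Lagrange // subsetIl. Qed.

Lemma natr_card_class_neq0 (gT : finGroupType) (K : {group gT}) (x : gT) :
  #|x ^: K|%:R != 0 :> algC.
Proof.
by rewrite pnatr_eq0 -lt0n; apply/card_gt0P; exists x; apply: class_refl.
Qed.

(** Presents the joint centralizer as the stabilizer of [x] under conjugation by ['C_G[y]], the form
    in which orbit-stabilizer applies. *)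
Lemma setI_subcent1 (gT : finGroupType) (G : {group gT}) (x y : gT) :
  'C_G[x] :&: 'C_G[y] = 'C_('C_G[y])[x].
Proof. by rewrite setIACA setIid (setIC 'C[x]) setIA. Qed.

(** Class functions are summed twice: over [z] in [G], then over [h] in ['C_G[z]]. The two class
    sizes divided by the order of [G] leave the inverse order of the joint centralizer, by
    orbit-stabilizer in [G] and in ['C_G[z]]. *)
Lemma sum_commuting_pairs (gT : finGroupType) (G : {group gT})
    (ClG : {set gT}) (ClC : gT -> {set gT}) (f : gT -> gT -> algC) :
  is_transversal ClG (classes G) G ->
  (forall z, z \in ClG -> is_transversal (ClC z) (classes 'C_G[z]) 'C_G[z]) ->
  (forall z h u, u \in G -> f (z ^ u)%g (h ^ u)%g = f z h) ->
  (forall z h, h \notin 'C[z] -> f z h = 0) ->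
  #|G|%:R^-1 * (\sum_(z in G) \sum_(h in G) f z h) =
    \sum_(z in ClG) \sum_(h in ClC z) #|'C_G[h] :&: 'C_G[z]|%:R^-1 * f z h.
Proof.
move=> trG trC fJ f0.
rewrite (sum_transversal trG) => [|z u Gz Gu]; last first.
  rewrite (reindex_inj (conjg_inj u)); apply: eq_big => h; first exact: groupJr.
  by rewrite fJ.
rewrite mulr_sumr; apply: eq_bigr => z Xz.
rewrite (_ : \sum_(h in G) f z h = \sum_(h in 'C_G[z]) f z h); last first.
  rewrite [LHS](bigID (mem 'C[z])) /= [X in _ + X]big1 ?addr0 => [|h /andP[_]].
    by apply: eq_bigl => h; rewrite [RHS]inE.
  exact: f0.
rewrite (sum_transversal (trC z Xz)) => [|h u _ /setIP[Gu czu]]; last first.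
  (* As [u] fixes [z], conjugating [h] alone amounts to conjugating the pair. *)
  by rewrite -[in LHS](conjg_fixP _ : z ^ u = z)%g ?fJ //; apply/commgP/commute_sym/cent1P.
rewrite !mulr_sumr; apply: eq_bigr => h _; rewrite !mulrA setI_subcent1.
congr (_ * _).
rewrite -(card_class_cent1 G z) -(card_class_cent1 'C_G[z] h) !natrM !invfM.
rewrite (mulrAC _ _ #|z ^: G|%:R) mulVf ?natr_card_class_neq0 // mul1r.
by rewrite mulrAC mulVf ?natr_card_class_neq0 // mul1r.
Qed.

(** The sum over [z] is a class function [N] of [h] supported on the class of [g], and [N g] is the
    sum defining [pair_nu]; the class size over the order of [G] gives the factor
    [#|'C_G[g]|^-1]. *)
Lemma pair_nu_sum (gT : finGroupType) (G : {group gT}) (m : int) (g : gT)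
    (eta : 'CF('C_G[g])) :
  g \in G ->
  pair_nu m eta =
    #|G|%:R^-1 *
      \sum_(z in G) \sum_(h in G) (gamma G m z h)%:R * pair_char eta h z.
Proof.
move=> Gg; rewrite exchange_big /=.
pose N h := \sum_(z in G) (gamma G m z h)%:R * pair_char eta h z.
have NJ h u : u \in G -> N (h ^ u)%g = N h.
  move=> Gu; rewrite /N (reindex_inj (conjg_inj u)).
  by apply: eq_big => z; rewrite ?groupJr // => _; rewrite gammaJ ?pair_charJ.
have Ng : N g = \sum_(x in G | expgz x m == expgz (g * x)%g m) eta (expgz x m).
  (* Sort the [x] by the common value [z] of the two powers: the fibre over [z] is the set counted
     by [gamma G m z g]. *)
  rewrite (partition_big (fun x => expgz x m) (mem G)) /=; last first.
    by move=> x /andP[Gx _]; apply: expgz_in.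
  apply: eq_bigr => z _; rewrite (@pair_charE _ _ _ _ _ _ 1%g) //; last first.
    by rewrite lconjE invg1 conjg1.
  rewrite lconjE invg1 conjg1.
  rewrite (eq_bigr (fun=> eta z)) => [|x /andP[_ /eqP->] //].
  rewrite sumr_const mulr_natl /gamma; congr (_ *+ _); apply: eq_card => x.
  rewrite inE -[RHS]topredE /= -andbA; congr (_ && _).
  by rewrite [RHS]andbC; case: eqP => //= ->; rewrite eq_sym.
rewrite (_ : \sum_(h in G) _ = \sum_(h in g ^: G) N g); last first.
  rewrite (big_setID (g ^: G)) /= addrC big1 ?add0r => [|h].
    rewrite (setIidPr _) ?class_subG //.
    by apply: eq_bigr => _ /imsetP[u Gu ->]; apply: NJ.
  case/setDP=> _ ngh; apply: big1 => z _; rewrite pair_char0 ?mulr0 // => u Gu.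
  by rewrite lconjE => hu; case/imsetP: ngh; exists u; rewrite // -hu conjgKV.
rewrite sumr_const -[N g *+ _]mulr_natl mulrA /pair_nu Ng; congr (_ * _).
rewrite -(card_class_cent1 G g) natrM invfM mulrC mulrA divff ?mul1r //.
exact: natr_card_class_neq0.
Qed.

Lemma pair_nu_transversal (gT : finGroupType) (G : {group gT}) (m : int)
    (ClG : {set gT}) (ClC : gT -> {set gT}) (g : gT) (eta : 'CF('C_G[g])) :
  is_transversal ClG (classes G) G ->
  (forall z, z \in ClG -> is_transversal (ClC z) (classes 'C_G[z]) 'C_G[z]) ->
  g \in G ->
  pair_nu m eta =
    \sum_(z in ClG) \sum_(h in ClC z)
       #|'C_G[h] :&: 'C_G[z]|%:R^-1 * ((gamma G m z h)%:R * pair_char eta h z).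
Proof.
move=> trG trC Gg; rewrite pair_nu_sum // (sum_commuting_pairs trG trC) //.
  by move=> z h u Gu; rewrite gammaJ ?pair_charJ.
by move=> z h nczh; rewrite gamma_eq0 ?mul0r.
Qed.

Theorem proposition5p1 (gT : finGroupType) (G : {group gT}) (m : int)
    (ClG : {set gT}) (ClC : gT -> {set gT}) (t : gT -> gT -> gT)
    (hClG : is_transversal ClG (classes G) G)
    (hClC : forall z, z \in ClG ->
       is_transversal (ClC z) (classes 'C_G[z]) 'C_G[z])
    (ht : forall z h, z \in ClG -> h \in ClC z ->
       t h z \in G /\ lconj (t h z) h \in ClG) :
  (forall V : dmodule G,
     module_nu m V =
       \sum_(z in ClG) \sum_(h in ClC z)
          #|'C_G[h] :&: 'C_G[z]|%:R^-1 * (gamma G m z h)%:R *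
            module_char V (lconj (t h z) h) (lconj (t h z) z)) /\
  (forall (g : gT) (eta : 'CF('C_G[g])), g \in ClG -> eta \in irr 'C_G[g] ->
     pair_nu m eta =
       #|'C_G[g]|%:R^-1 *
         \sum_(z in ClG) \sum_(h in ClC z | lconj (t h z) h == g)
            #|z ^: 'C_G[h]|%:R * (gamma G m z h)%:R *
              eta (lconj (t h z) z)).
Proof.
have GsubX x : x \in ClG -> x \in G.
  by case/and3P: hClG => _ /subsetP sXG _; apply: sXG.
(* Conjugating both arguments by [t h z] does not change the character, so the choice of [t] is
   immaterial. *)
have charE z h g (eta : 'CF('C_G[g])) : z \in ClG -> h \in ClC z ->
    pair_char eta (lconj (t h z) h) (lconj (t h z) z) = pair_char eta h z.
  by move=> Xz Ch; case: (ht z h Xz Ch) => Gt _; rewrite !lconjE pair_charJ ?groupV.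
split=> [V | g eta Xg _].
  rewrite /module_nu (eq_bigr _ (fun s _ =>
    pair_nu_transversal m (dchar s) hClG hClC (dbase_in s))).
  rewrite exchange_big; apply: eq_bigr => z Xz.
  rewrite exchange_big; apply: eq_bigr => h Ch.
  rewrite -!mulr_sumr -mulrA /module_char; congr (_ * (_ * _)).
  by apply: eq_bigr => s _; rewrite charE.
rewrite (pair_nu_transversal _ _ hClG hClC) ?GsubX // mulr_sumr.
apply: eq_bigr => z Xz; rewrite [in RHS]big_mkcondr mulr_sumr /=.
apply: eq_bigr => h Ch; rewrite -charE //; have [Gt Xgh] := ht z h Xz Ch.
(* If [h] were conjugate to [g], then [g] and [lconj (t h z) h] would be conjugate elements of
   [ClG], hence equal; so all other [h] contribute zero. *)
case: eqP => [tg | ntg]; last first.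
  rewrite pair_char0 ?mulr0 // => u Gu; rewrite lconjE => eg; case: ntg.
  apply: (transversal_class_inj hClG) => //; rewrite class_sym.
  by rewrite -eg memJ_class ?groupV.
(* The two centralizers are conjugate by [t h z]. *)
have cardC : #|'C_G[g]| = #|'C_G[h]|.
  by rewrite -tg lconjE cent1J -(cardJg 'C_G[h] (t h z)^-1) conjIg conjGid ?groupV.
rewrite (pair_charE _ _ (group1 G)) ?lconjE ?invg1 ?conjg1 // -?lconjE //.
rewrite !mulrA cardC; congr (_ * _ * _).
(* Orbit-stabilizer for ['C_G[h]] acting on [z] turns the inverse order of the joint centralizer
   into [#|z ^: 'C_G[h]|] over [#|'C_G[h]|]. *)
rewrite setIC setI_subcent1 -(card_class_cent1 'C_G[h] z) natrM invfM mulrAC.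
by rewrite mulVf ?mul1r // natr_card_class_neq0.
Qed.
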